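(* Let $(a,b)\in\mathcal H_{\mathrm{II}}^+$ and $\phi=\phi_{a,b}$. Then $J(\phi)$ is finite if and only if there exists $N\ge1$ such that every $\phi$-periodic ball $B_r(x,y)\subseteq B_1(0,0)$ has minimal period at most $N$.
   Context: $K$ is a field complete and locally compact with respect to a nontrivial non-Archimedean absolute value $|\cdot|$, whose residue field has odd characteristic; radii of balls are taken in the value group $|K^\times|$. $\|(x,y)\|=\max(|x|,|y|)$, $B_r(c_1,c_2)=\{\|(x,y)-(c_1,c_2)\|\le r\}$. $\phi_{a,b}(x,y)=(a+by-x^2,x)$, $\mathcal H_{\mathrm{II}}^+=\{(a,b):|a|\le1,0<|b|<1\}$; $J(\phi)$ is the set of points of $K^2$ with bounded two-sided orbit under $\phi$. A ball $B_r(x,y)\subseteq B_1(0,0)$ is $\phi$-periodic if $\phi^n(B_r(x,y))\subseteq B_r(x,y)$ for some $n\ge1$; the least such $n$ is its minimal period. *)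

(* Defs.v *)
From HB Require Import structures.
From mathcomp Require Import all_boot all_order all_algebra.
From mathcomp Require Import boolp classical_sets functions cardinality reals.
From mathcomp Require Import topology.

Set Implicit Arguments.
Unset Strict Implicit.
Unset Printing Implicit Defensive.
Import Order.TTheory GRing.Theory Num.Theory.
Local Open Scope classical_set_scope.
Local Open Scope ring_scope.

(* The library's normed structures cannot be used for [K]: they require
   `|x *+ n| = `|x| *+ n, which no non-Archimedean absolute value satisfies. *)
Record nonarch_absval (R : realType) (K : fieldType) := NonarchAbsval {
  absval :> K -> R;
  absval_ge0 : forall x, 0 <= absval x;
  absval_eq0 : forall x, absval x = 0 <-> x = 0;
  absvalM : forall x y, absval (x * y) = absval x * absval y;
  absvalD : forall x y, absval (x + y) <= Num.max (absval x) (absval y) }.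

(* [K] with the metric [v (x - y)]; the phantom argument [v] lets the topology
   be inferred. *)
Definition absval_metric (R : realType) (K : fieldType)
  (v : nonarch_absval R K) : Type := K.

Section AbsvalTheory.
Variables (R : realType) (K : fieldType) (v : nonarch_absval R K).

Lemma absval0 : v 0 = 0. Proof. exact/absval_eq0. Qed.

Lemma absval1 : v 1 = 1.
Proof.
have v1_neq0 : v 1 != 0.
  by apply/eqP => /absval_eq0 /eqP; rewrite oner_eq0.
by apply: (mulfI v1_neq0); rewrite -absvalM !mulr1.
Qed.

Lemma absvalN x : v (- x) = v x.
Proof.
apply/eqP; rewrite -(@eqrXn2 _ 2) ?absval_ge0//.
by rewrite !expr2 -!absvalM mulrNN.
Qed.

Lemma absvalB x y : v (x - y) <= Num.max (v x) (v y).
Proof. by rewrite -(absvalN y); exact: absvalD. Qed.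

Definition nontrivial_absval : Prop := exists2 x : K, x != 0 & v x != 1.

Definition value_group : set R := [set r | exists2 x : K, x != 0 & r = v x].

HB.instance Definition _ := Choice.on (absval_metric v).
HB.instance Definition _ := isPointed.Build (absval_metric v) (0 : K).
HB.instance Definition _ :=
  hasNbhs.Build (absval_metric v)
    (nbhs_ (entourage_ (ball_ v : K -> R -> set K))).

Fact absval_ball_center (x : absval_metric v) (e : R) : 0 < e -> ball_ v x e x.
Proof. by move=> e_gt0 /=; rewrite subrr absval0. Qed.

Fact absval_ball_sym (x y : absval_metric v) (e : R) : ball_ v x e y -> ball_ v y e x.
Proof. by rewrite /= -absvalN opprB. Qed.

Fact absval_ball_triangle (x y z : absval_metric v) (e1 e2 : R) :
  ball_ v x e1 y -> ball_ v y e2 z -> ball_ v x (e1 + e2) z.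
Proof.
move=> /= xy yz.
have e1_gt0 := le_lt_trans (absval_ge0 v _) xy.
have e2_gt0 := le_lt_trans (absval_ge0 v _) yz.
rewrite -(subrKA (y : K)) (le_lt_trans (absvalD _ _ _))// gt_max.
by rewrite (lt_le_trans xy) ?lerDl ?ltW// (lt_le_trans yz) ?lerDr ?ltW.
Qed.

HB.instance Definition _ := Nbhs_isPseudoMetric.Build R (absval_metric v)
  erefl absval_ball_center absval_ball_sym absval_ball_triangle erefl.

(* Predicate version of the axiom of the library's [completeType]. *)
Definition complete_absval : Prop :=
  forall F : set_system (absval_metric v), ProperFilter F -> cauchy F -> cvg F.

Definition locally_compact_absval : Prop :=
  locally_compact [set: absval_metric v].

Definition absval_integer : {pred K} := [pred x | v x <= 1].

Fact integer_subring_closed : subring_closed absval_integer.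
Proof.
split; rewrite ?inE/= ?absval1// => x y; rewrite !inE => x_le1 y_le1.
  by rewrite (le_trans (absvalB _ _))// ge_max x_le1.
by rewrite absvalM mulr_ile1 ?absval_ge0.
Qed.

HB.instance Definition _ :=
  GRing.isSubringClosed.Build K absval_integer integer_subring_closed.

Definition valuation_ring : Type := {x : K | x \in absval_integer}.

HB.instance Definition _ := SubChoice.on valuation_ring.
HB.instance Definition _ :=
  [SubChoice_isSubComNzRing of valuation_ring by <:].

Definition maximal_ideal : {pred valuation_ring} :=
  [pred x : valuation_ring | v (\val x) < 1].

Fact maximal_ideal_idealr : idealr_closed maximal_ideal.
Proof.
split=> [||c x y].
- by rewrite !inE /= absval0 ltr01.
- by rewrite !inE /= absval1 ltxx.
rewrite !inE /= => x_lt1 y_lt1.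
rewrite (le_lt_trans (absvalD _ _ _))// gt_max y_lt1 andbT absvalM.
have c_le1 : v (\val c) <= 1 := valP c.
by rewrite (le_lt_trans _ x_lt1)// ler_piMl ?absval_ge0.
Qed.

HB.instance Definition _ :=
  isIdealr.Build valuation_ring maximal_ideal maximal_ideal_idealr.

Definition residue_field := {ideal_quot maximal_ideal}.

Definition odd_residue_char : Prop :=
  exists2 p : nat, p \in [pchar residue_field] & odd p.

Definition plane_norm (p : K * K) : R := Num.max (v p.1) (v p.2).

Definition plane_ball (r : R) (c : K * K) : set (K * K) :=
  [set p | plane_norm (p - c) <= r].

End AbsvalTheory.

Arguments maximal_ideal {R K} v.

Section Henon.
Variables (K : fieldType) (a b : K).

Definition henon (p : K * K) : K * K := (a + b * p.2 - p.1 ^+ 2, p.1).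

Definition henon_inv (p : K * K) : K * K := (p.2, (p.1 - a + p.2 ^+ 2) / b).

Lemma henonK : b != 0 -> cancel henon henon_inv.
Proof.
by move=> b0 [x y]; congr pair; rewrite /= addrAC addrNK addrC addKr mulrC mulKf.
Qed.

Lemma henon_invK : b != 0 -> cancel henon_inv henon.
Proof.
move=> b0 [x y]; congr pair; rewrite /= mulrCA mulfV// mulr1.
by rewrite addrA addrK addrC subrK.
Qed.

End Henon.

Section Dynamics.
Variables (R : realType) (K : fieldType) (v : nonarch_absval R K).

Definition henon_region_II_plus : set (K * K) :=
  [set ab | v ab.1 <= 1 /\ 0 < v ab.2 < 1].

(* [iter n (henon_inv a b)] is the backward iterate only if [b != 0]. *)
Definition henon_julia (a b : K) : set (K * K) :=
  [set p | exists M : R, forall n : nat,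
    plane_norm v (iter n (henon a b) p) <= M /\
    plane_norm v (iter n (henon_inv a b) p) <= M].

Definition periodic_ball (f : K * K -> K * K) (r : R) (c : K * K) : Prop :=
  [/\ value_group v r,
      plane_ball v r c `<=` plane_ball v 1 (0, 0) &
      exists2 n : nat, (0 < n)%N &
        iter n f @` plane_ball v r c `<=` plane_ball v r c].

Definition minimal_period (f : K * K -> K * K) (B : set (K * K)) (n : nat) :
    Prop :=
  [/\ (0 < n)%N, iter n f @` B `<=` B &
      forall m : nat, (0 < m)%N -> iter m f @` B `<=` B -> (n <= m)%N].

Lemma periodic_ball_minimal_period f r c :
  periodic_ball f r c -> exists n, minimal_period f (plane_ball v r c) n.
Proof.
move=> [_ _ [n n0 fn]].
pose P k := (0 < k)%N && `[< iter k f @` plane_ball v r c `<=` plane_ball v r c >].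
have exP : exists k, P k by exists n; rewrite /P n0; exact/asboolP.
have [k /andP[k0 /asboolP fk] kmin] := ex_minnP exP.
exists k; split=> // m m0 fm; apply: kmin; rewrite /P m0; exact/asboolP.
Qed.

End Dynamics.

(* Main.v *)
(* On the unit ball [henon a b] is 1-Lipschitz, and the Julia set is the set of
   points whose backward orbit stays in the unit ball.  By compactness an
   invariant ball contains a point of J; if J is finite this point is periodic of
   period at most #|J|, and so is the ball since the map is 1-Lipschitz.
   Conversely every point of J is recurrent, hence every small enough ball
   centred on it is periodic; if the periods are at most N, then J consists of
   fixed points of the N!-th iterate.  Their coordinates solve a system
   [x_i ^+ 2 = linear], and modulo such a system every polynomial reduces to a
   combination of squarefree monomials, so there are finitely many solutions. *)
Require Import Defs.
From HB Require Import structures.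
From mathcomp Require Import all_boot all_order all_algebra.
From mathcomp Require Import boolp classical_sets functions cardinality reals.
From mathcomp Require Import topology.
From mathcomp Require Import ring.
Set Implicit Arguments.
Unset Strict Implicit.
Unset Printing Implicit Defensive.
Import Order.TTheory GRing.Theory Num.Theory.
Local Open Scope classical_set_scope.
Local Open Scope ring_scope.

(** * Functions that agree on a set with combinations of squarefree monomials *)

Section SquarefreeSpan.
Variables (K : fieldType) (I : finType).

Definition squarefree_monomial (A : {set I}) (x : I -> K) : K :=
  \prod_(i in A) x i.

(** Agreement is required on [S] only, so the equations that cut out [S] may be used to rewrite
    [f]. *)
Definition squarefree_span (S : set (I -> K)) (f : (I -> K) -> K) : Prop :=
  exists c : {set I} -> K,
    forall x, S x -> f x = \sum_(A : {set I}) c A * squarefree_monomial A x.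

Variable S : set (I -> K).

Lemma squarefree_span_ext f g : (forall x, S x -> f x = g x) ->
  squarefree_span S f -> squarefree_span S g.
Proof. by move=> fg [c fc]; exists c => x Sx; rewrite -fg// fc. Qed.

Lemma squarefree_spanD f g : squarefree_span S f -> squarefree_span S g ->
  squarefree_span S (fun x => f x + g x).
Proof.
move=> [c fc] [d gd]; exists (fun A => c A + d A) => x Sx.
by rewrite fc// gd// -big_split/=; apply: eq_bigr => A _; rewrite mulrDl.
Qed.

Lemma squarefree_spanZ k f : squarefree_span S f ->
  squarefree_span S (fun x => k * f x).
Proof.
move=> [c fc]; exists (fun A => k * c A) => x Sx.
by rewrite fc// mulr_sumr; apply: eq_bigr => A _; rewrite mulrA.
Qed.

Lemma squarefree_span0 : squarefree_span S (fun=> 0).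
Proof. by exists (fun=> 0) => x _; rewrite big1// => A _; rewrite mul0r. Qed.

Lemma squarefree_span_sum (J : finType) (f : J -> (I -> K) -> K) :
  (forall j, squarefree_span S (f j)) ->
  squarefree_span S (fun x => \sum_j f j x).
Proof.
move=> fS; elim: (index_enum J) => [|j r ih].
  by apply: squarefree_span_ext squarefree_span0 => x _; rewrite big_nil.
apply: squarefree_span_ext (squarefree_spanD (fS j) ih) => x _.
by rewrite big_cons.
Qed.

Lemma squarefree_span_monomial A : squarefree_span S (squarefree_monomial A).
Proof.
exists (fun B => (B == A)%:R) => x _.
rewrite (bigD1 A)//= eqxx mul1r big1 ?addr0// => B /negbTE ->.
by rewrite mul0r.
Qed.

End SquarefreeSpan.

(** * Finiteness for systems that express every square linearly *)

Section SquareSystem.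
Variables (K : fieldType) (I : finType) (a b : K) (s t : I -> I).

Definition square_system : set (I -> K) :=
  [set x | forall i, x i ^+ 2 = a + b * x (s i) - x (t i)].

Let V : ((I -> K) -> K) -> Prop := squarefree_span square_system.

(* Substituting the equation for [x i ^+ 2] lowers the degree by one, hence the
   induction on the size of [A]. *)
Lemma squarefree_spanX_monomial i A :
  V (fun x => x i * squarefree_monomial A x).
Proof.
have [n] := ubnP #|A|; elim: n => // n ih in i A *; rewrite ltnS => An.
have [iA|iA] := boolP (i \in A); last first.
  apply: squarefree_span_ext (squarefree_span_monomial _ (i |: A)) => x _.
  by rewrite /squarefree_monomial big_setU1.
have AiA : (#|A :\ i| < n)%N by rewrite (leq_trans _ An)// [#|A|](cardsD1 i) iA.
have := squarefree_spanD
  (squarefree_spanZ a (squarefree_span_monomial _ (A :\ i)))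
  (squarefree_spanD (squarefree_spanZ b (ih (s i) _ AiA))
                    (squarefree_spanZ (-1) (ih (t i) _ AiA))).
apply: squarefree_span_ext => x Sx.
rewrite [in RHS]/squarefree_monomial (big_setD1 i iA)/=.
rewrite -/(squarefree_monomial (A :\ i) x).
by rewrite [RHS]mulrA -expr2 Sx mulN1r !mulrDl mulNr !addrA mulrA.
Qed.

Lemma squarefree_spanX i f : V f -> V (fun x => x i * f x).
Proof.
move=> [c fc].
apply: (@squarefree_span_ext _ _ _
  (fun x => \sum_A c A * (x i * squarefree_monomial A x))) => [x Sx|].
  by rewrite fc// mulr_sumr; apply: eq_bigr => A _; rewrite mulrCA.
apply: squarefree_span_sum => A; apply: squarefree_spanZ.
exact: squarefree_spanX_monomial.
Qed.

(** Interpolation: each [z] in [r] other than [y] contributes a factor [(x i - z i) / (y i - z i)],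
    where [i] is a coordinate separating the two; multiplication by such a factor preserves [V]. *)
Lemma squarefree_span_indicator (y : I -> K) (r : seq {ffun I -> K}) :
  exists2 f, V f & f y = 1 /\
    forall x : {ffun I -> K}, x \in r -> (x : I -> K) <> y -> f x = 0.
Proof.
elim: r => [|z r [f Vf [fy fr]]].
  exists (squarefree_monomial finset.set0).
    exact: squarefree_span_monomial.
  by split=> //; rewrite /squarefree_monomial big_set0.
have [zy|zy] := pselect ((z : I -> K) = y).
  exists f => //; split=> // x; rewrite inE => /orP[/eqP -> //|]; exact: fr.
have [i zyi] : exists i, z i != y i.
  apply: contrapT => zy'; apply: zy; apply/funext => i.
  by apply/eqP/negPn/negP => ?; apply: zy'; exists i.
exists (fun x => (y i - z i)^-1 * (x i * f x + - z i * f x)).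
  apply/squarefree_spanZ/squarefree_spanD; first exact: squarefree_spanX.
  exact: squarefree_spanZ.
split=> [|x]; first by rewrite -mulrDl fy mulr1 mulVf// subr_eq0 eq_sym.
rewrite inE => /orP[/eqP -> _|xr xy]; first by rewrite -mulrDl subrr mul0r mulr0.
by rewrite fr// !mulr0 addr0 mulr0.
Qed.

(* Squarefree monomials span all functions on the solution set, so there are at
   most as many solutions as monomials. *)
Lemma size_square_system (r : seq {ffun I -> K}) : uniq r ->
  (forall x, x \in r -> square_system x) -> (size r <= 2 ^ #|I|)%N.
Proof.
move=> r_uniq rS; pose pt k := tnth (in_tuple r) k.
(* [M] evaluates the monomials at the points of [r]. The coefficients of the indicator functions
   form a left inverse, so [M] has rank [size r], which is at most its number of rows. *)
pose M : 'M[K]_(#|{set I}|, size r) :=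
  \matrix_(A, k) squarefree_monomial (enum_val A) (pt k).
suff /row_fullP /eqP <- : exists B, B *m M = 1%:M.
  rewrite (leq_trans (rank_leq_row _))// -(cardsT I) -card_powerset.
  by apply/subset_leq_card/fintype.subsetP => A _; rewrite powersetE finset.subsetT.
have /choice[c cP] k : exists c : {set I} -> K, forall l,
    \sum_A c A * squarefree_monomial A (pt l) = (k == l)%:R.
  have [f [c fc] [fk fr]] := squarefree_span_indicator (pt k) r.
  exists c => l; rewrite -fc; last exact/rS/mem_tnth.
  have [<- //|kl] := eqVneq k l.
  rewrite fr ?mem_tnth// => lk; case/eqP: kl.
  by apply/(tuple_uniqP (in_tuple r) r_uniq)/ffunP => i; rewrite -/(pt k) -lk.
exists (\matrix_(k, A) c k (enum_val A)); apply/matrixP => k l.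
rewrite !mxE -cP [RHS](reindex _ (onW_bij _ (@enum_val_bij {set I})))/=.
by apply: eq_bigr => A _; rewrite !mxE.
Qed.

End SquareSystem.

(** * Periodic orbits and fixed points of Henon iterates *)

Lemma iter_modn (T : Type) (f : T -> T) (m k : nat) (p : T) :
  iter m f p = p -> iter (k %% m) f p = iter k f p.
Proof.
move=> fp; rewrite [in RHS](divn_eq k m) addnC iterD; congr iter.
by elim: (k %/ m)%N => // j ih; rewrite mulSn iterD -ih.
Qed.

(** Pigeonhole among the first [(size s).+1] iterates; injectivity cancels the initial segment of
    the orbit. *)
Lemma finite_orbit_periodic (T : eqType) (f : T -> T) (s : seq T) (p : T) :
  injective f -> (forall n, iter n f p \in s) ->
  exists2 n, (0 < n <= size s)%N & iter n f p = p.
Proof.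
move=> f_inj ps.
have /(uniqPn p)[i [j [ij]]] :
    ~~ uniq [seq iter n f p | n <- iota 0 (size s).+1].
  apply/negP => /uniq_leq_size sub_le.
  have := sub_le s; rewrite size_map size_iota ltnn => sub.
  by suff: false by []; apply: sub => _ /mapP[n _ ->].
rewrite size_map size_iota => js.
have i_lt := ltn_trans ij js.
rewrite !(nth_map 0%N) ?size_iota// !nth_iota// !add0n => fij.
exists (j - i)%N; first by rewrite subn_gt0 ij (leq_trans (leq_subr _ _)).
have finj : injective (iter i f) by elim: (i) => // k ih x y /f_inj/ih.
by apply: finj; rewrite -iterD subnKC// ltnW.
Qed.

Lemma dvdn_iter_invariant (T : Type) (f : T -> T) (B : set T) (m n : nat) :
  (m %| n)%N ->
  iter m f @` B `<=` B -> iter n f @` B `<=` B.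
Proof.
move=> /dvdnP[k ->] mB _ [q Bq <-].
elim: k => // k ih; rewrite mulSn iterD; exact/mB/imageP.
Qed.

(* The first coordinates of an [m]-periodic orbit satisfy
   [x_i ^+ 2 = a + b * x_(i-1) - x_(i+1)], with indices modulo [m]. *)
Lemma finite_henon_fixpoints (K : fieldType) (a b : K) (m : nat) : (0 < m)%N ->
  finite_set [set p | iter m (henon a b) p = p].
Proof.
case: m => // m _; set f := henon a b.
pose itin p : {ffun 'I_m.+1 -> K} := [ffun i : 'I_m.+1 => (iter i f p).1].
apply: contrapT => /(@infinite_set_fset _ _ (2 ^ m.+1).+1)[B Bfix].
apply/negP; rewrite -leqNgt -(size_map itin) -[m.+1 in X in (_ <= X)%N]card_ord.
apply: (@size_square_system _ _ a b (@ord_pred _) (@ordS _)).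
  rewrite map_inj_in_uniq ?finmap.fset_uniq// => p q /Bfix/= fp /Bfix/= fq pq.
  (* Entries [0] and [m] of the itinerary recover both coordinates of a periodic point, the second
     one because [p' = f (iter m f p')]. *)
  have snd_itin p' : f (iter m f p') = p' -> p'.2 = (iter m f p').1.
    by move=> {1}<-.
  have /ffunP/(_ ord_max) := pq; rewrite !ffunE/= -!snd_itin//.
  have /ffunP/(_ ord0) := pq; rewrite !ffunE/=.
  by case: (p) (q) => [x y] [z w]/= -> ->.
move=> _ /mapP[p /Bfix/= fp ->] i; rewrite !ffunE/= !iter_modn//=.
(* The cyclic predecessor of [i] appears as [(i + m.+1).-1], so [i = 0] needs no separate case. *)
rewrite -[X in _ = _ + _ * X - _]/(f (iter (i + m.+1).-1 f p)).2 -iterS.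
by rewrite prednK ?addnS// -addnS iterD (fp : iter m.+1 f p = p) opprB addrC subrK.
Qed.

(** * Ultrametric estimates in the plane *)

Section PlaneNorm.
Variables (R : realType) (K : fieldType) (v : nonarch_absval R K).
Implicit Types (p q : K * K) (r : R).

Lemma absvalD_le r (x y : K) : v x <= r -> v y <= r -> v (x + y) <= r.
Proof. by move=> xr yr; rewrite (le_trans (absvalD _ _ _))// ge_max xr. Qed.

Lemma absvalB_le r (x y : K) : v x <= r -> v y <= r -> v (x - y) <= r.
Proof. by move=> xr yr; rewrite absvalD_le// absvalN. Qed.

Lemma absvalX (x : K) n : v (x ^+ n) = v x ^+ n.
Proof. by elim: n => [|n ih]; rewrite ?expr0 ?absval1// !exprS absvalM ih. Qed.

Lemma absvalV (x : K) : v x^-1 = (v x)^-1.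
Proof.
have [->|x0] := eqVneq x 0; first by rewrite invr0 absval0 invr0.
apply: (mulfI (x := v x)); first by apply: contra x0 => /eqP/absval_eq0/eqP.
rewrite -absvalM mulfV// absval1 mulfV//.
by apply: contra x0 => /eqP/absval_eq0/eqP.
Qed.

Lemma absval_gt0 (x : K) : (0 < v x) = (x != 0).
Proof.
rewrite lt_neqAle absval_ge0 andbT eq_sym; congr (~~ _).
by apply/eqP/eqP => [/absval_eq0 //|->]; rewrite absval0.
Qed.

Lemma absval_addl (x y : K) : v y < v x -> v (x + y) = v x.
Proof.
move=> yx; apply/eqP; rewrite eq_le absvalD_le//=; last exact: ltW.
have := absvalB v (x + y) y; rewrite addrK le_max => /orP[//|].
by move=> /(lt_le_trans yx); rewrite ltxx.
Qed.

(** The cofactor [x + y] of the difference of squares is integral. *)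
Lemma absval_sqrB_le (x y : K) : v x <= 1 -> v y <= 1 ->
  v (x ^+ 2 - y ^+ 2) <= v (x - y).
Proof.
move=> x1 y1; rewrite subr_sqr absvalM ler_piMr ?absval_ge0//.
exact: absvalD_le.
Qed.

Lemma plane_norm_leP p r :
  reflect (v p.1 <= r /\ v p.2 <= r) (plane_norm v p <= r).
Proof. by rewrite /plane_norm ge_max; exact: andP. Qed.

Lemma plane_norm_distC p q : plane_norm v (p - q) = plane_norm v (q - p).
Proof. by rewrite /plane_norm /= -absvalN opprB -(absvalN _ (_ - q.2)) opprB. Qed.

Lemma plane_normD_le p q r :
  plane_norm v p <= r -> plane_norm v q <= r -> plane_norm v (p + q) <= r.
Proof.
by move=> /plane_norm_leP[? ?] /plane_norm_leP[? ?]; apply/plane_norm_leP; split;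
  exact: absvalD_le.
Qed.

Lemma plane_dist_trans q p s r : plane_norm v (p - q) <= r ->
  plane_norm v (q - s) <= r -> plane_norm v (p - s) <= r.
Proof. by move=> pq qs; rewrite -(subrKA q) plane_normD_le. Qed.

Lemma plane_norm_le_near p q r :
  plane_norm v (p - q) <= r -> plane_norm v p <= r -> plane_norm v q <= r.
Proof.
rewrite plane_norm_distC => qp pr.
by rewrite -(subrK p q) plane_normD_le.
Qed.

Lemma plane_dist_eq0 p q :
  (forall e, 0 < e -> plane_norm v (p - q) <= e) -> p = q.
Proof.
move=> pq; suff: p.1 - q.1 = 0 /\ p.2 - q.2 = 0.
  by case: p q {pq} => [x y] [z w]/= [/subr0_eq-> /subr0_eq->].
by split; apply/(absval_eq0 v)/eqP; rewrite eq_le absval_ge0 andbT;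
  apply/ler_addgt0Pl => e /pq/plane_norm_leP[? ?]; rewrite addr0.
Qed.

End PlaneNorm.

(** * Small scalars and compactness of the unit ball *)

Lemma expr_unbounded (R : archiRealFieldType) (c M : R) : 1 < c ->
  exists n, M < c ^+ n.
Proof.
move=> c1; have c0 : 0 < c - 1 by rewrite subr_gt0.
have bern n : (c - 1) *+ n <= c ^+ n.
  elim: n => [|n ih]; first by rewrite mulr0n expr0.
  rewrite mulrS exprS -[c in c * _](subrK 1) mulrDl mul1r lerD// ler_peMr//.
    exact: ltW.
  by rewrite exprn_ege1// ltW.
have [n Mn] : exists n : nat, M / (c - 1) < n%:R.
  by exists (Num.bound `|M / (c - 1)|); rewrite (le_lt_trans (ler_norm _))// archi_boundP.
by exists n; rewrite (lt_le_trans _ (bern n))// -mulr_natr mulrC -ltr_pdivrMr.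
Qed.

Lemma absval_arbitrarily_small (R : realType) (K : fieldType)
    (v : nonarch_absval R K) (e : R) :
  nontrivial_absval v -> 0 < e -> exists2 x : K, x != 0 & v x < e.
Proof.
move=> [y y0 y1] e0.
wlog {y1} : y y0 / 1 < v y => [wl|y1].
  have [vy1|vy1|vy1] := ltgtP 1 (v y); last by rewrite -vy1 eqxx in y1.
    exact: (wl y).
  by apply: (wl y^-1); rewrite ?invr_eq0// absvalV invf_gt1// absval_gt0.
have [n en] := expr_unbounded e^-1 y1.
exists (y ^- n); first by rewrite invr_eq0 expf_neq0.
by rewrite absvalV absvalX invf_plt// ?posrE// exprn_gt0// absval_gt0.
Qed.

Definition cluster_point (R : realType) (K : fieldType) (v : nonarch_absval R K)
    (u : nat -> K * K) (z : K * K) : Prop :=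
  forall (e : R) (k : nat), 0 < e ->
    exists2 n, (k <= n)%N & plane_norm v (u n - z) <= e.

(** Local compactness only provides some compact neighbourhood [C] of [0]. Scaling by a small [y]
    moves the sequence into the product of [C] with itself, and division by [y] brings a cluster
    point back. *)
Lemma plane_cluster_point (R : realType) (K : fieldType)
    (v : nonarch_absval R K) (u : nat -> K * K) :
  nontrivial_absval v -> locally_compact_absval v ->
  (forall n, plane_norm v (u n) <= 1) -> exists z, cluster_point v u z.
Proof.
move=> ntv /(_ 0 I)[C].
rewrite /within/= => /nbhs_ballP[d/= d0 dC] [Cc _] u_le1.
have [y y0 yd] := absval_arbitrarily_small ntv d0.
pose w n : absval_metric v * absval_metric v := (y * (u n).1, y * (u n).2).
have yC (x : K) : v x <= 1 -> C (y * x).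
  move=> x1; apply: dC => //; rewrite /ball/= sub0r absvalN absvalM.
  by rewrite (le_lt_trans _ yd)// ler_piMr ?absval_ge0.
have CCc := compact_setX Cc Cc.
have [z [_ zw]] : (C `*` C) `&` cluster (w @ \oo) !=set0.
  apply: CCc; exists 0%N => // n _ /=.
  by have /plane_norm_leP[] := u_le1 n; split; exact: yC.
exists (z.1 / y, z.2 / y) => e k e0.
have vy0 : 0 < v y by rewrite absval_gt0.
have eN : 0 < e * v y by rewrite mulr_gt0.
have [] := zw [set q | exists2 n, (k <= n)%N & w n = q]
  [set q | ball z.1 (e * v y) q.1 /\ ball z.2 (e * v y) q.2].
- by exists k => // n /= kn; exists n.
- by exists (ball z.1 (e * v y), ball z.2 (e * v y)) => //=; split; exact: nbhsx_ballx.
move=> _ [[n kn <-]] [/= z1 z2]; exists n => //; apply/plane_norm_leP => /=.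
by split; rewrite -(ler_pM2r vy0) -absvalM mulrBl divfK// mulrC -absvalN opprB ltW.
Qed.

(** * Dynamics of the Henon map: escape, Julia set, recurrence *)

Section HenonDynamics.
Variables (R : realType) (K : fieldType) (v : nonarch_absval R K) (a b : K).
Hypothesis abII : henon_region_II_plus v (a, b).

Local Notation f := (henon a b).
Local Notation g := (henon_inv a b).
Local Notation nrm := (plane_norm v).

Let a_le1 : v a <= 1. Proof. by case: abII. Qed.
Let b_gt0 : 0 < v b. Proof. by case: abII => _ /andP[]. Qed.
Let b_le1 : v b <= 1. Proof. by case: abII => _ /andP[_ /ltW]. Qed.
Let b_neq0 : b != 0. Proof. by rewrite -(absval_gt0 v). Qed.
Let fK : cancel f g. Proof. exact: henonK. Qed.
Let gK : cancel g f. Proof. exact: henon_invK. Qed.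

Lemma henon_unit_ball p : nrm p <= 1 -> nrm (f p) <= 1.
Proof.
move=> /plane_norm_leP[p1 p2]; apply/plane_norm_leP; split=> //=.
by rewrite absvalB_le ?absvalD_le// ?absvalM ?absvalX ?exprn_ile1 ?mulr_ile1 ?absval_ge0.
Qed.

Lemma iter_henon_unit_ball n p : nrm p <= 1 -> nrm (iter n f p) <= 1.
Proof. by move=> p1; elim: n => //= n; exact: henon_unit_ball. Qed.

Lemma henon_contract p q r : nrm p <= 1 -> nrm q <= 1 ->
  nrm (p - q) <= r -> nrm (f p - f q) <= r.
Proof.
move=> /plane_norm_leP[p1 _] /plane_norm_leP[q1 _] /plane_norm_leP[/= pq1 pq2].
apply/plane_norm_leP; split=> //=.
have -> : a + b * p.2 - p.1 ^+ 2 - (a + b * q.2 - q.1 ^+ 2) =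
    b * (p.2 - q.2) - (p.1 ^+ 2 - q.1 ^+ 2) by ring.
apply: absvalB_le; last exact: le_trans (absval_sqrB_le p1 q1) pq1.
by rewrite absvalM (le_trans _ pq2)// ler_piMl ?absval_ge0.
Qed.

Lemma iter_henon_contract n p q r : nrm p <= 1 -> nrm q <= 1 ->
  nrm (p - q) <= r -> nrm (iter n f p - iter n f q) <= r.
Proof.
move=> p1 q1 pq; elim: n => //= n ih.
by rewrite henon_contract ?iter_henon_unit_ball.
Qed.

Lemma henon_inv_lipschitz p q r : nrm p <= 1 -> nrm q <= 1 ->
  nrm (p - q) <= r * v b -> nrm (g p - g q) <= r.
Proof.
move=> /plane_norm_leP[_ p2] /plane_norm_leP[_ q2] /plane_norm_leP[/= pq1 pq2].
apply/plane_norm_leP; split=> /=.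
  have r0 : 0 <= r by rewrite -(pmulr_lge0 _ b_gt0) (le_trans _ pq1)// absval_ge0.
  by rewrite (le_trans pq2)// ler_piMr.
have -> : (p.1 - a + p.2 ^+ 2) / b - (q.1 - a + q.2 ^+ 2) / b =
    ((p.1 - q.1) + (p.2 ^+ 2 - q.2 ^+ 2)) / b by ring.
rewrite absvalM absvalV ler_pdivrMr// absvalD_le//.
exact: le_trans (absval_sqrB_le p2 q2) pq2.
Qed.

(** Escape argument shared by both directions of time: [u] will be the absolute value of one
    coordinate, which grows geometrically along an orbit that cannot leave [P]. *)
Lemma expanding_unbounded (h : K * K -> K * K) (P : set (K * K))
    (u : K * K -> R) (c M : R) (p : K * K) :
  (forall q, u q <= nrm q) -> (forall q, P q -> P (h q) /\ c * u q <= u (h q)) ->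
  1 < c -> P p -> 1 <= u p -> (forall n, nrm (iter n h p) <= M) -> False.
Proof.
move=> u_norm Ph c1 Pp up bd; have [n] := expr_unbounded M c1.
apply/negP; rewrite -leNgt (le_trans _ (bd n))// (le_trans _ (u_norm _))//.
suff [] : P (iter n h p) /\ c ^+ n <= u (iter n h p) by [].
elim: n => //= n [Pn cn]; have [Pn1 un1] := Ph _ Pn; split=> //.
by rewrite exprS (le_trans _ un1)// ler_pM2l// (lt_trans _ c1).
Qed.

(* If [|x| > 1] and [|x| >= |y|] the forward orbit escapes, and if [|y| > 1] and
   [|y| >= |x|] the backward orbit does. *)
Lemma henon_julia_unit_ball p : henon_julia v a b p -> nrm p <= 1.
Proof.
move=> [M bd]; apply/plane_norm_leP.
have [p21|p21] := leP (v p.2) (v p.1).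
  suff p11 : v p.1 <= 1 by split=> //; exact: le_trans p11.
  rewrite leNgt; apply/negP => p11.
  (* The region keeps the first coordinate at least as large as initially, which makes [v p.1] a
     uniform expansion factor. *)
  apply: (@expanding_unbounded f
    [set q | v p.1 <= v q.1 /\ v q.2 <= v q.1] (v \o fst) (v p.1) M p) => //=.
  - by move=> q; rewrite /plane_norm le_max lexx.
  - move=> q [pq q21]; have q11 := lt_le_trans p11 pq.
    (* The square strictly dominates: both [a] and [b * q.2] are bounded by [v q.1], which is less
       than its square. *)
    have fq : v (a + b * q.2 - q.1 ^+ 2) = v q.1 ^+ 2.
      rewrite addrC absval_addl absvalN absvalX//.
      have q1q : v q.1 < v q.1 ^+ 2 by rewrite expr2 ltr_pMl// (lt_trans _ q11).
      rewrite (le_lt_trans _ q1q)// absvalD_le//.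
        by rewrite (le_trans a_le1)// ltW.
      by rewrite absvalM (le_trans _ q21)// ler_piMl ?absval_ge0.
    have qq : v q.1 <= v q.1 ^+ 2 by rewrite expr2 ler_peMl ?absval_ge0// ltW.
    rewrite fq; split; first by split=> //; exact: le_trans qq.
    by rewrite expr2 ler_wpM2r ?absval_ge0.
  - exact: ltW.
  - by move=> n; have [] := bd n.
suff p22 : v p.2 <= 1 by split=> //; exact: le_trans (ltW p21) p22.
rewrite leNgt; apply/negP => p22.
apply: (@expanding_unbounded g
  [set q | v p.2 <= v q.2 /\ v q.1 <= v q.2] (v \o snd) (v p.2) M p) => //=.
- by move=> q; rewrite /plane_norm le_max lexx orbT.
- move=> q [pq q12]; have q21 := lt_le_trans p22 pq.
  (* Again the square dominates the numerator, and division by [b] cannot shrink it as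
     [v b <= 1]. *)
  have gq : v q.2 ^+ 2 <= v ((q.1 - a + q.2 ^+ 2) / b).
    rewrite absvalM absvalV addrC absval_addl absvalX.
      by rewrite ler_pdivlMr// ler_piMr// exprn_ge0// absval_ge0.
    have q2q : v q.2 < v q.2 ^+ 2 by rewrite expr2 ltr_pMl// (lt_trans _ q21).
    by rewrite (le_lt_trans _ q2q)// absvalB_le// (le_trans a_le1)// ltW.
  have qq : v q.2 <= v q.2 ^+ 2 by rewrite expr2 ler_peMl ?absval_ge0// ltW.
  split; first by split; apply: le_trans gq => //; exact: le_trans qq.
  by rewrite (le_trans _ gq)// expr2 ler_wpM2r ?absval_ge0.
- by split=> //; exact: ltW.
- exact: ltW.
- by move=> n; have [] := bd n.
Qed.

(** Forward iterates never leave the unit ball; conversely, a backward iterate of a Julia point is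
    again a Julia point, hence lies in the unit ball. *)
Lemma henon_juliaP p : henon_julia v a b p <-> forall n, nrm (iter n g p) <= 1.
Proof.
split=> [Jp n|p1]; last first.
  by exists 1 => n; split=> //; apply: iter_henon_unit_ball; exact: p1 0%N.
apply: henon_julia_unit_ball; elim: n => //= n [M bd]; exists M => -[|k].
  by have [_] := bd 1%N.
have [fk _] := bd k; have [_ gk] := bd k.+2.
by rewrite -[iter k.+1 g _]iterSr iterSr gK.
Qed.

Lemma henon_julia_henon p : henon_julia v a b p -> henon_julia v a b (f p).
Proof.
move=> /henon_juliaP p1; apply/henon_juliaP => -[|n].
  exact/henon_unit_ball/(p1 0%N).
by rewrite iterSr fK.
Qed.

(* The set of cluster points of a forward orbit is stable under [henon_inv]. *)
Lemma cluster_point_julia q z : nrm q <= 1 ->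
  cluster_point v (fun n => iter n f q) z -> henon_julia v a b z.
Proof.
move=> q1 qz; apply/henon_juliaP => n.
have cluster_le1 w : cluster_point v (fun n => iter n f q) w -> nrm w <= 1.
  by move=> /(_ 1 0%N ltr01)[k _] /plane_norm_le_near; apply; exact: iter_henon_unit_ball.
apply: (cluster_le1); elim: n => //= n ih e k e0.
(* An index of at least [k.+1] leaves one forward step for the inverse to undo; the factor [v b]
   compensates for the expansion by the inverse. *)
have [[//|m] km nz] := ih (e * v b) k.+1 (mulr_gt0 e0 b_gt0).
exists m => //; rewrite -(fK (iter m f q)); apply: henon_inv_lipschitz nz.
  exact: iter_henon_unit_ball m.+1 q q1.
exact: cluster_le1.
Qed.

(** The returns of the centre under [iter n f] stay in the ball and accumulate at some [z], which is
    within [r] of one of them. A cluster point of this subsequence is one of the whole orbit. *)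
Lemma invariant_ball_julia r c n : nontrivial_absval v ->
  locally_compact_absval v -> value_group v r ->
  plane_ball v r c `<=` plane_ball v 1 (0, 0) -> (0 < n)%N ->
  iter n f @` plane_ball v r c `<=` plane_ball v r c ->
  exists2 z, plane_ball v r c z & henon_julia v a b z.
Proof.
move=> ntv lcv [x x0 rx] rc1 n0 fn.
have r0 : 0 < r by rewrite rx absval_gt0.
have le1 z : plane_ball v r c z -> nrm z <= 1.
  by move=> /rc1; rewrite /plane_ball/= subr0.
have cc : plane_ball v r c c by apply/plane_norm_leP; rewrite /= !subrr absval0 ltW.
have fc k : plane_ball v r c (iter (k * n) f c).
  elim: k => // k ih; rewrite mulSn iterD; apply: fn; exact: imageP.
have [z cz] := plane_cluster_point ntv lcv (fun k => le1 _ (fc k)).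
exists z.
  have [k _ kz] := cz r 0%N r0; apply: plane_dist_trans (fc k).
  by rewrite plane_norm_distC.
apply: (@cluster_point_julia c); first exact: le1.
move=> e k e0; have [m km mz] := cz e k e0; exists (m * n)%N => //.
by rewrite (leq_trans km)// leq_pmulr.
Qed.

(* Two points of the backward orbit of [p] are [r]-close; push them forward. *)
Lemma julia_recurrent p r : nontrivial_absval v -> locally_compact_absval v ->
  henon_julia v a b p -> 0 < r ->
  exists2 n, (0 < n)%N & nrm (iter n f p - p) <= r.
Proof.
move=> ntv lcv /henon_juliaP p1 r0.
have [z pz] := plane_cluster_point ntv lcv p1.
have [k _ kz] := pz r 0%N r0; have [m km mz] := pz r k.+1 r0.
have gn j : iter j f (iter j g p) = p.
  by elim: j => // j ih; rewrite iterSr [iter j.+1 g p]iterS gK.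
exists (m - k)%N; first by rewrite subn_gt0.
rewrite -[in X in nrm (_ - X)](gn m) -{1}(gn k) -iterD subnK; last exact: ltnW.
apply: iter_henon_contract => //; apply: plane_dist_trans kz _.
by rewrite plane_norm_distC.
Qed.

Lemma recurrent_ball_invariant p r n : nrm p <= 1 -> r <= 1 ->
  nrm (iter n f p - p) <= r -> iter n f @` plane_ball v r p `<=` plane_ball v r p.
Proof.
move=> p1 r1 pn _ [q pq <-]; apply: plane_dist_trans pn.
apply: iter_henon_contract => //.
by apply: plane_norm_le_near p1; rewrite plane_norm_distC (le_trans _ r1).
Qed.

End HenonDynamics.

Theorem theorem4p6 (R : realType) (K : fieldType) (v : nonarch_absval R K)
    (v_nontrivial : nontrivial_absval v)
    (v_complete : complete_absval v)
    (v_locally_compact : locally_compact_absval v)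
    (v_odd : odd_residue_char v)
    (a b : K) (abII : henon_region_II_plus v (a, b)) :
  finite_set (henon_julia v a b) <->
  exists2 N : nat, (1 <= N)%N &
    forall (r : R) (c : K * K), periodic_ball v (henon a b) r c ->
      forall n : nat, minimal_period (henon a b) (plane_ball v r c) n ->
        (n <= N)%N.
Proof.
split=> [/finite_seqP[s Js]|[N _ N_bound]].
  (* The successor ensures [1 <= N] even for empty [s]. *)
  exists (size s).+1 => // r c [r_val rc1 [m m0 fm]] n [n0 fn n_min].
  have [z cz Jz] :=
    invariant_ball_julia abII v_nontrivial v_locally_compact r_val rc1 m0 fm.
  have Jiter k : henon_julia v a b (iter k (henon a b) z).
    by elim: k => //= k; exact: henon_julia_henon.
  have finj : injective (henon a b).
    apply: (can_inj (henonK a _)); rewrite -(absval_gt0 v).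
    by case: abII => _ /andP[].
  have [|k /andP[k0 ks] fk] := finite_orbit_periodic (s := s) (p := z) finj.
    by move=> k; have := Jiter k; rewrite Js.
  rewrite (leq_trans _ (leqW ks))// n_min// => _ [q cq <-].
  have le1 w : plane_ball v r c w -> plane_norm v w <= 1.
    by move=> /rc1; rewrite /plane_ball/= subr0.
  (* The ball follows [z]: the [k]-th iterate fixes [z] and does not increase distances, so the
     image of [q] stays within [r] of [z]. *)
  apply: (@plane_dist_trans _ _ _ z) (cz); rewrite -fk.
  apply: (iter_henon_contract abII); rewrite ?le1//.
  by rewrite (@plane_dist_trans _ _ _ c)// plane_norm_distC.
apply: sub_finite_set (finite_henon_fixpoints a b (fact_gt0 N)) => p Jp /=.
have p1 := henon_julia_unit_ball abII Jp.
apply: (@plane_dist_eq0 _ _ v) => e e0.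
(* The radius [v x] must lie in the value group, be at most [1] to keep the ball inside the unit
   ball, and be at most [e]. *)
have min_gt0 : 0 < Num.min 1 e by rewrite lt_min ltr01.
have [x x0] := absval_arbitrarily_small v_nontrivial min_gt0.
rewrite lt_min => /andP[/ltW x1 /ltW xe].
have vx0 : 0 < v x by rewrite absval_gt0.
have [m m0 pm] := julia_recurrent abII v_nontrivial v_locally_compact Jp vx0.
have px : periodic_ball v (henon a b) (v x) p.
  split; [by exists x| |by exists m => //; exact: recurrent_ball_invariant].
  move=> q pq; rewrite /plane_ball/= subr0.
  by apply: plane_norm_le_near p1; rewrite plane_norm_distC (le_trans _ x1).
have [n pn] := periodic_ball_minimal_period px.
have [n0 fn _] := pn.
(* Every period up to [N] divides the factorial, so one exponent serves all radii and [p] moves by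
   at most [v x]. *)
have nN : (n %| N`!)%N by rewrite dvdn_fact// n0 (N_bound _ _ px).
apply: le_trans xe; apply: (dvdn_iter_invariant nN fn).
by apply: imageP; apply/plane_norm_leP; rewrite /= !subrr absval0 ltW.
Qed.
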